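(* Let $p,q$ be probability distributions on a finite set $\mathcal X$ and suppose $0\le\varepsilon\le\frac{d_{\mathrm{hel}}^2(p,q)}{9}$. Then $$n^*_{\mathrm{TV}}(\varepsilon)\asymp n^*_{\mathrm{Hub}}(\varepsilon)\asymp n^*_{\mathrm{Sub}}(\varepsilon)\asymp\frac{1}{d_{\mathrm{hel}}^2(p,q)}.$$
   Context: $\Delta(\mathcal X)$ is the set of probability distributions on $\mathcal X$; $d_{\mathrm{TV}}(p,q)=\frac12\sum_x|p(x)-q(x)|$; $d_{\mathrm{hel}}^2(p,q)=\sum_x(\sqrt{p(x)}-\sqrt{q(x)})^2$. The uncertainty sets are $\mathcal P_{\mathrm{Hub}}(p,\varepsilon)=\{(1-\varepsilon)p+\varepsilon h: h\in\Delta(\mathcal X)\}$, $\mathcal P_{\mathrm{TV}}(p,\varepsilon)=\{p'\in\Delta(\mathcal X): d_{\mathrm{TV}}(p',p)\le\varepsilon\}$, $\mathcal P_{\mathrm{Sub}}(p,\varepsilon)=\{p'\in\Delta(\mathcal X): p'(x)\le(1+\varepsilon)p(x)\ \forall x\}$. For $A\in\{\mathrm{Hub},\mathrm{TV},\mathrm{Sub}\}$, $n^*_A(\varepsilon)$ is the smallest $n$ for which there is a (possibly randomised) test $\phi:\mathcal X^n\to\{0,1\}$ with $\sup_{P\in\mathcal P_A(p,\varepsilon)}\mathbb P_{P^{\otimes n}}(\phi=1)+\sup_{Q\in\mathcal P_A(q,\varepsilon)}\mathbb P_{Q^{\otimes n}}(\phi=0)\le\frac1{10}$ ($\infty$ if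 there is none; $1/0=\infty$). $f\asymp g$ means $c\,g\le f\le C\,g$ with universal constants $c,C>0$ (independent of $p,q,\varepsilon$). *)

(* Defs.v *)
From HB Require Import structures.
From mathcomp Require Export all_boot all_order all_algebra.
From mathcomp Require Export all_classical all_reals ereal.

Set Implicit Arguments.
Unset Strict Implicit.
Unset Printing Implicit Defensive.

Import Order.TTheory GRing.Theory Num.Theory.

Local Open Scope classical_set_scope.
Local Open Scope ring_scope.

Section RobustTesting.
Context {R : realType}.

Definition Delta (X : finType) : set (X -> R) :=
  [set p | (forall x, 0 <= p x) /\ \sum_x p x = 1].

Definition dTV (X : finType) (p q : X -> R) : R :=
  2^-1 * \sum_x `|p x - q x|.

(* Unnormalised: the value lies in [0, 2] on probability distributions. *)
Definition dhel2 (X : finType) (p q : X -> R) : R :=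
  \sum_x (Num.sqrt (p x) - Num.sqrt (q x)) ^+ 2.

Definition PHub (X : finType) (p : X -> R) (eps : R) : set (X -> R) :=
  [set (fun x => (1 - eps) * p x + eps * h x) | h in @Delta X].

Definition PTV (X : finType) (p : X -> R) (eps : R) : set (X -> R) :=
  [set p' | Delta p' /\ dTV p' p <= eps].

Definition PSub (X : finType) (p : X -> R) (eps : R) : set (X -> R) :=
  [set p' | Delta p' /\ forall x, p' x <= (1 + eps) * p x].

Definition prodDist (X : finType) (n : nat) (P : X -> R) :
    {ffun 'I_n -> X} -> R :=
  fun x => \prod_(i < n) P (x i).

(* A randomised test is a Markov kernel from X^n to {0,1}: [phi x b] is the
   probability of the answer b on the sample x, and true stands for 1.
   Deterministic tests are the kernels with values in {0,1}. *)
Definition is_test (X : finType) (n : nat)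
    (phi : {ffun 'I_n -> X} -> bool -> R) : Prop :=
  forall x, Delta (phi x).

Definition prTest (X : finType) (n : nat) (P : X -> R)
    (phi : {ffun 'I_n -> X} -> bool -> R) (b : bool) : R :=
  \sum_x prodDist P x * phi x b.

(* When the uncertainty sets are nonempty sets of distributions, both suprema
   are over nonempty subsets of [0, 1], so the real-valued [sup] is genuine. *)
Definition robustly_testable (X : finType)
    (A : (X -> R) -> R -> set (X -> R)) (p q : X -> R) (eps : R)
    (n : nat) : Prop :=
  exists phi : {ffun 'I_n -> X} -> bool -> R,
    is_test phi /\
    sup [set prTest P phi true | P in A p eps]
      + sup [set prTest Q phi false | Q in A q eps] <= 10^-1.

(* The infimum of a set of naturals is its least element if there is one, and
   the infimum of the empty set is +oo. *)
Definition nstar (X : finType) (A : (X -> R) -> R -> set (X -> R))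
    (p q : X -> R) (eps : R) : \bar R :=
  ereal_inf [set n%:R%:E | n in robustly_testable A p q eps].

End RobustTesting.

(* Main.v *)
Require Import Defs.
From mathcomp Require Import all_boot all_order all_algebra.
From mathcomp Require Import all_classical all_reals ereal.
From mathcomp Require Import ring lra.

Set Implicit Arguments.
Unset Strict Implicit.
Unset Printing Implicit Defensive.

Import Order.TTheory GRing.Theory Num.Theory.

Local Open Scope ring_scope.

(** Upper bound. The Huber and subtraction sets lie inside the total variation
    ball, so only the latter must be tested. The score
    [(sqrt q - sqrt p) / (sqrt q + sqrt p)] takes values between [-1] and [1], its means
    under [q] and [p] differ by exactly [h = dhel2 p q], and its second moment
    under either is at most [h]. A perturbation of size [eps <= h / 9] in total
    variation moves means by at most [2 eps] and second moments by at most
    [2 eps], so a gap of order [h] and a variance of order [h] survive, and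
    Chebyshev's inequality makes the empirical mean of the score a good test as
    soon as [n] exceeds a multiple of [1 / h].

    Lower bound. [p] and [q] belong to their own uncertainty sets, the Hellinger
    affinity tensorises, [1 - n h / 2 <= (1 - h / 2) ^ n], and the affinity is
    bounded by an affine function of the total error of any test. *)

(** * Moments and deviations under product distributions *)

Section ProductMeasure.
Context {R : realType} {X : finType}.
Implicit Types (P f : X -> R) (n : nat).

Lemma sum_prodDist_prod n P (g : 'I_n -> X -> R) :
  \sum_x prodDist P x * \prod_i g i (x i) = \prod_i \sum_a P a * g i a.
Proof.
rewrite bigA_distr_bigA; apply: eq_bigr => x _.
by rewrite /prodDist -big_split.
Qed.

Lemma prodDist_ge0 n P (x : {ffun 'I_n -> X}) :
  (forall a, 0 <= P a) -> 0 <= prodDist P x.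
Proof. by move=> P0; apply: prodr_ge0. Qed.

Lemma sum_prodDist n P :
  \sum_a P a = 1 -> \sum_(x : {ffun 'I_n -> X}) prodDist P x = 1.
Proof.
move=> P1; rewrite /prodDist -(bigA_distr_bigA (fun _ : 'I_n => P)).
by rewrite big1.
Qed.

(** By independence and centring the cross terms vanish; only the [n] diagonal terms remain. *)
Lemma sum_prodDist_sqr n P f :
  \sum_a P a = 1 -> \sum_a P a * f a = 0 ->
  \sum_(x : {ffun 'I_n -> X}) prodDist P x * (\sum_i f (x i)) ^+ 2
    = n%:R * \sum_a P a * f a ^+ 2.
Proof.
move=> P1 Pf0.
(* [g i j] spreads [f (x i) * f (x j)] over all coordinates, so that the sum over samples
   factorises; for [i = j] both factors fall on the same coordinate. *)
pose g (i j k : 'I_n) a := (if k == i then f a else 1) * (if k == j then f a else 1).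
have gE i j (x : {ffun 'I_n -> X}) : f (x i) * f (x j) = \prod_k g i j k (x k).
  rewrite /g big_split /= -!big_mkcond /=.
  by rewrite !(big_pred1 _ (fun k => erefl)).
transitivity (\sum_i \sum_j \prod_k \sum_a P a * g i j k a).
  under eq_bigr => x _.
    rewrite expr2 big_distrlr mulr_sumr /=.
    under eq_bigr do rewrite mulr_sumr.
    over.
  rewrite exchange_big; apply: eq_bigr => i _.
  rewrite exchange_big; apply: eq_bigr => j _.
  by rewrite -sum_prodDist_prod; apply: eq_bigr => x _; rewrite gE.
rewrite -[n in RHS]card_ord -sumr_const mulr_suml; apply: eq_bigr => i _.
rewrite mul1r (bigD1 i) //= [X in _ + X]big1 ?addr0 => [|j ji].
  rewrite (bigD1 i) //= [X in _ * X]big1 ?mulr1 => [|k ki].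
    by apply: eq_bigr => a _; rewrite /g eqxx expr2.
  by under eq_bigr do rewrite /g (negPf ki) !mulr1.
rewrite (bigD1 i) //=; under eq_bigr do rewrite /g eqxx eq_sym (negPf ji) mulr1.
by rewrite Pf0 mul0r.
Qed.

Lemma chebyshev_prodDist n P f (t : R) :
  Delta P -> \sum_a P a * f a = 0 -> (0 < n)%N -> 0 < t ->
  \sum_(x : {ffun 'I_n -> X}) prodDist P x * (n%:R * t <= \sum_i f (x i))%R%:R
    <= (\sum_a P a * f a ^+ 2) / (n%:R * t ^+ 2).
Proof.
move=> [P0 P1] Pf0 n0 t0.
have nt0 : 0 < n%:R * t :> R by rewrite mulr_gt0 ?ltr0n.
have -> : (\sum_a P a * f a ^+ 2) / (n%:R * t ^+ 2)
    = (n%:R * \sum_a P a * f a ^+ 2) / (n%:R * t) ^+ 2.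
  by field; rewrite (gt_eqF t0) pnatr_eq0 -lt0n.
rewrite ler_pdivlMr ?exprn_gt0 // -(@sum_prodDist_sqr n) // mulr_suml.
apply: ler_sum => x _; rewrite -mulrA ler_wpM2l ?prodDist_ge0 //.
case: (lerP _ (\sum_i f (x i))) => [le_S|_]; last by rewrite mul0r sqr_ge0.
by rewrite mul1r ler_pXn2r ?nnegrE ?(ltW nt0) ?(le_trans (ltW nt0)).
Qed.

Lemma test_sum1 n (phi : {ffun 'I_n -> X} -> bool -> R) x :
  is_test phi -> phi x false = 1 - phi x true.
Proof. by move=> /(_ x)[_]; rewrite big_bool /= => <-; rewrite addrC addrK. Qed.

Lemma prTest_le1 n P (phi : {ffun 'I_n -> X} -> bool -> R) b :
  Delta P -> is_test phi -> prTest P phi b <= 1.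
Proof.
move=> [P0 P1] phiP; rewrite -(@sum_prodDist n _ P1).
apply: ler_sum => x _; rewrite -[leRHS]mulr1 ler_wpM2l ?prodDist_ge0 //.
have [phi0 _] := phiP x; have := test_sum1 x phiP.
by case: b; have := phi0 false; have := phi0 true; lra.
Qed.

End ProductMeasure.

(** * Hellinger affinity and the lower bound on the sample size *)

Definition affinity {R : realType} {X : finType} (p q : X -> R) : R :=
  \sum_x Num.sqrt (p x * q x).

Section Hellinger.
Context {R : realType} {X : finType}.
Implicit Types p q P Q : X -> R.

Lemma dhel2C p q : dhel2 p q = dhel2 q p.
Proof. by apply: eq_bigr => x _; rewrite -sqrrN opprB. Qed.

Lemma dhel2_ge0 p q : 0 <= dhel2 p q.
Proof. by apply: sumr_ge0 => x _; rewrite sqr_ge0. Qed.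

Lemma affinity_ge0 p q : 0 <= affinity p q.
Proof. by apply: sumr_ge0 => x _; rewrite sqrtr_ge0. Qed.

Lemma affinityE p q : Delta p -> Delta q -> affinity p q = 1 - dhel2 p q / 2.
Proof.
move=> [p0 p1] [q0 q1].
have -> : dhel2 p q = \sum_x (p x + q x - 2 * Num.sqrt (p x * q x)).
  apply: eq_bigr => x _; rewrite sqrtrM // sqrrB !sqr_sqrtr //.
  by rewrite -mulr_natl; ring.
rewrite sumrB big_split /= p1 q1 -mulr_sumr -/(affinity p q).
by field.
Qed.

Lemma dhel2_le2 p q : Delta p -> Delta q -> dhel2 p q <= 2.
Proof. by move=> pD qD; have := affinity_ge0 p q; rewrite affinityE //; lra. Qed.

Lemma affinity_prodDist n p q : Delta p -> Delta q ->
  affinity (@prodDist R X n p) (@prodDist R X n q) = affinity p q ^+ n.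
Proof.
move=> [p0 _] [q0 _].
rewrite -[n in RHS]card_ord -prodr_const bigA_distr_bigA.
apply: eq_bigr => x _; rewrite /prodDist -big_split /=.
have rhs0 : 0 <= \prod_i Num.sqrt (p (x i) * q (x i)).
  by apply: prodr_ge0 => i _; rewrite sqrtr_ge0.
apply/eqP; rewrite -(@eqrXn2 _ 2) ?sqrtr_ge0 //.
rewrite sqr_sqrtr; last by apply: prodr_ge0 => i _; rewrite mulr_ge0.
by rewrite -prodrXl; apply/eqP/eq_bigr => i _; rewrite sqr_sqrtr ?mulr_ge0.
Qed.

Lemma sqrtM_le_test (a b u : R) : 0 <= a -> 0 <= b -> 0 <= u -> u <= 1 ->
  2 * Num.sqrt (a * b) <= 3 / 2 * (a * u + b * (1 - u)) + (a + b) / 2.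
Proof.
move=> a0 b0 u0 u1; rewrite sqrtrM //.
have := sqr_sqrtr a0; have := sqr_sqrtr b0.
move: (Num.sqrt a) (Num.sqrt b) (sqrtr_ge0 a) (sqrtr_ge0 b) => r s r0 s0 sb ra.
rewrite -{}sb -{}ra in a0 b0 *.
(* The right-hand side interpolates between [2 r^2 + s^2/2] and
   [r^2/2 + 2 s^2], each of which dominates [2 r s]. *)
have H1 := sqr_ge0 (2 * r - s); have H2 := sqr_ge0 (r - 2 * s).
have H3 := mulr_ge0 u0 H1.
have H4 : 0 <= (1 - u) * (r - 2 * s) ^+ 2 by rewrite mulr_ge0 // subr_ge0.
by nra.
Qed.

Lemma bernoulli_le (x : R) n : 0 <= x <= 1 -> 1 - n%:R * x <= (1 - x) ^+ n.
Proof.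
move=> /andP[x0 x1]; elim: n => [|n IH]; first by rewrite mul0r subr0 expr0.
rewrite exprS -natr1; apply: (@le_trans _ _ ((1 - x) * (1 - n%:R * x))).
  have : 0 <= n%:R * x ^+ 2 by rewrite mulr_ge0 ?sqr_ge0.
  by lra.
by rewrite ler_wpM2l // subr_ge0.
Qed.

(** With [h = dhel2 p q], the affinity of the products is at least [1 - n h / 2], while total error
    [1/10] forces it below [23/40]; hence even [n h >= 17/20]. *)
Lemma prTest_lower n (phi : {ffun 'I_n -> X} -> bool -> R) p q :
  Delta p -> Delta q -> is_test phi ->
  prTest p phi true + prTest q phi false <= 10^-1 ->
  2^-1 <= n%:R * dhel2 p q.
Proof.
move=> pD qD phiP err.
(* Sum [sqrtM_le_test] over samples, with [a], [b] the two likelihoods and [u] the probability of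
   answering [true]; half the two total masses gives the [+ 1]. *)
have aff_le : 2 * affinity (@prodDist R X n p) (@prodDist R X n q)
    <= 3 / 2 * (prTest p phi true + prTest q phi false) + 1.
  have mass : (\sum_(x : {ffun 'I_n -> X}) prodDist p x
               + \sum_(x : {ffun 'I_n -> X}) prodDist q x) / 2 = 1.
    by rewrite !sum_prodDist; [lra|case: qD|case: pD].
  rewrite -[X in _ + X]mass /prTest /affinity -!big_split /= !mulr_sumr mulr_suml -big_split /=.
  apply: ler_sum => x _; rewrite (test_sum1 x phiP).
  have [phi0 _] := phiP x; have := test_sum1 x phiP; have := phi0 false => phif E.
  have [[p0 _] [q0 _]] := (pD, qD).
  by apply: sqrtM_le_test => //; rewrite ?prodDist_ge0 //; lra.
move: aff_le; rewrite affinity_prodDist // affinityE // => aff_le.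
have h0 := dhel2_ge0 p q; have h2 := dhel2_le2 pD qD.
have h01 : 0 <= dhel2 p q / 2 <= 1 by apply/andP; split; lra.
have := bernoulli_le n h01.
by rewrite mulrA; lra.
Qed.

(** * The score function *)

(** A bounded surrogate of the log-likelihood ratio: [tanh (log (q x / p x) / 4)] when both masses
    are positive, and [0] by the convention on division when both vanish. *)
Definition score p q x : R :=
  (Num.sqrt (q x) - Num.sqrt (p x)) / (Num.sqrt (q x) + Num.sqrt (p x)).

Lemma scoreC p q x : score q p x = - score p q x.
Proof. by rewrite /score -mulNr opprB [X in _ / X]addrC. Qed.

(** Here [r] and [s] stand for the roots of [p x] and [q x]. The three parts serve the range, the
    mean gap and the second moment; they rest on [s^2 - r^2 = (s - r) (s + r)] and [r <= s + r]. *)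
Lemma score_spec (r s : R) : 0 <= r -> 0 <= s ->
  [/\ `|(s - r) / (s + r)| <= 1,
      (s ^+ 2 - r ^+ 2) * ((s - r) / (s + r)) = (r - s) ^+ 2 &
      r ^+ 2 * ((s - r) / (s + r)) ^+ 2 <= (r - s) ^+ 2].
Proof.
move=> r0 s0; have [/eqP|rs0] := eqVneq (s + r) 0.
  rewrite paddr_eq0 // => /andP[/eqP -> /eqP ->].
  by rewrite !(subr0, mul0r, expr0n, normr0, mulr0) /=; split.
have rs : 0 < s + r by rewrite lt_neqAle eq_sym rs0 addr_ge0.
split.
- rewrite normrM normfV (gtr0_norm rs) ler_pdivrMr // mul1r ler_norml.
  by apply/andP; split; lra.
- by field.
- rewrite expr_div_n mulrA ler_pdivrMr ?exprn_gt0 //.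
  rewrite [leLHS]mulrC -[(r - s) ^+ 2]sqrrN opprB ler_wpM2l ?sqr_ge0 //.
  by rewrite ler_pXn2r ?nnegrE ?(ltW rs) // lerDr.
Qed.

Lemma score_norm p q x : `|score p q x| <= 1.
Proof.
by have [] := @score_spec (Num.sqrt (p x)) (Num.sqrt (q x))
  (sqrtr_ge0 _) (sqrtr_ge0 _).
Qed.

Lemma sum_score p q : Delta p -> Delta q ->
  \sum_x q x * score p q x - \sum_x p x * score p q x = dhel2 p q.
Proof.
move=> [p0 _] [q0 _]; rewrite -sumrB; apply: eq_bigr => x _.
have [_ <- _] := @score_spec (Num.sqrt (p x)) (Num.sqrt (q x))
  (sqrtr_ge0 _) (sqrtr_ge0 _).
by rewrite !sqr_sqrtr // mulrBl.
Qed.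

Lemma sum_score_sqr p q : Delta p -> \sum_x p x * score p q x ^+ 2 <= dhel2 p q.
Proof.
move=> [p0 _]; apply: ler_sum => x _.
have [_ _] := @score_spec (Num.sqrt (p x)) (Num.sqrt (q x))
  (sqrtr_ge0 _) (sqrtr_ge0 _).
by rewrite sqr_sqrtr.
Qed.

End Hellinger.

(** * Inclusions between the uncertainty sets *)

Section UncertaintySets.
Context {R : realType} {X : finType}.
Implicit Types (p q P : X -> R) (eps : R).

Lemma PTV_center p eps : Delta p -> 0 <= eps -> PTV p eps p.
Proof.
move=> pD e0; split => //; rewrite /dTV big1 ?mulr0 // => x _.
by rewrite subrr normr0.
Qed.

Lemma PHub_center p eps : Delta p -> PHub p eps p.
Proof. by move=> pD; exists p => //; apply/funext => x; ring. Qed.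

Lemma PSub_center p eps : Delta p -> 0 <= eps -> PSub p eps p.
Proof.
by move=> pD e0; split => // x; have [p0 _] := pD; have := p0 x; nra.
Qed.

(** The mixture differs from [p] by [eps * (h - p)], and [|h - p| <= h + p] has total mass at most
    [2]. *)
Lemma PHub_sub_PTV p eps : Delta p -> 0 <= eps <= 1 ->
  (PHub p eps `<=` PTV p eps)%classic.
Proof.
move=> [p0 p1] /andP[e0 e1] _ [h [h0 h1] <-]; split.
  split=> [x|]; first by rewrite addr_ge0 ?mulr_ge0 ?subr_ge0.
  by rewrite big_split /= -!mulr_sumr p1 h1 !mulr1 subrK.
rewrite /dTV mulrC ler_pdivrMr //.
have -> : eps * 2 = \sum_x eps * (h x + p x).
  by rewrite -mulr_sumr big_split /= p1 h1.
apply: ler_sum => x _; have -> : (1 - eps) * p x + eps * h x - p x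
  = eps * (h x - p x) by ring.
rewrite normrM ger0_norm // ler_wpM2l // (le_trans (ler_normB _ _)) //.
by rewrite !ger0_norm.
Qed.

(* A density ratio at most [1 + eps] controls the positive part of [P - p], and
   [`|P - p| = 2 (P - p)^+ - (P - p)], whose last term sums to [0]. *)
Lemma PSub_sub_PTV p eps : Delta p -> 0 <= eps ->
  (PSub p eps `<=` PTV p eps)%classic.
Proof.
move=> [p0 p1] e0 P [[P0 P1] Ple]; split => //.
rewrite /dTV mulrC ler_pdivrMr //.
have -> : eps * 2 = \sum_x (2 * eps * p x - (P x - p x)).
  by rewrite !sumrB -mulr_sumr p1 P1 subrr subr0 mulr1 mulrC.
apply: ler_sum => x _; have := Ple x; have := p0 x => px Px.
have epx : 0 <= eps * p x by rewrite mulr_ge0.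
by rewrite ler_norml; apply/andP; split; lra.
Qed.

Lemma PTV_expect p eps P (g : X -> R) : PTV p eps P -> (forall x, `|g x| <= 1) ->
  \sum_x P x * g x <= \sum_x p x * g x + 2 * eps.
Proof.
move=> [_]; rewrite /dTV mulrC ler_pdivrMr // => Pp g1.
rewrite -lerBlDl -sumrB [2 * eps]mulrC (le_trans _ Pp) //; apply: ler_sum => x _.
rewrite -mulrBl (le_trans (ler_norm _)) // normrM -[leRHS]mulr1.
by rewrite ler_wpM2l.
Qed.

(** * The score test and its error *)

(** The threshold is the midpoint of the two means of the score, so it lies [h / 2] above the mean
    under [p], where [h = dhel2 p q]; Chebyshev's inequality is applied to the score centred under
    [P]. *)
Lemma score_test_error n p q eps P : Delta p -> Delta q ->
  0 < dhel2 p q -> 0 <= eps -> eps <= dhel2 p q / 9 -> PTV p eps P ->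
  (0 < n)%N ->
  \sum_(x : {ffun 'I_n -> X}) prodDist P x *
    (n%:R * ((\sum_a p a * score p q a + \sum_a q a * score p q a) / 2)
       <= \sum_i score p q (x i))%R%:R
    <= 16 / (n%:R * dhel2 p q).
Proof.
move=> pD qD h0 e0 eh Pp n0; have [PD _] := Pp; have [P0 P1] := PD.
have gap := sum_score pD qD.
have mean := PTV_expect Pp (score_norm p q).
have var : \sum_a P a * score p q a ^+ 2 <= 11 / 9 * dhel2 p q.
  have := @PTV_expect _ _ _ (fun a => score p q a ^+ 2) Pp.
  have := sum_score_sqr q pD => H1 H2.
  have {}H2 : \sum_a P a * score p q a ^+ 2
      <= \sum_a p a * score p q a ^+ 2 + 2 * eps.
    by apply: H2 => a; rewrite normrX exprn_ile1 // score_norm.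
  by move: H1 H2; lra.
set h := dhel2 p q in h0 eh gap var *.
set mp := \sum_a p a * score p q a in gap mean *.
set mq := \sum_a q a * score p q a in gap *.
pose mu := \sum_a P a * score p q a.
(* The margin left after the perturbation: [h / 2 - 2 h / 9 = 5 h / 18]. *)
have t0 : 0 < 5 / 18 * h by lra.
pose f a := score p q a - mu.
have Pf : \sum_a P a * f a = 0.
  under eq_bigr do rewrite mulrBr.
  by rewrite sumrB -mulr_suml P1 mul1r subrr.
have Pf2 : \sum_a P a * f a ^+ 2 <= 11 / 9 * h.
  apply: le_trans var.
  have -> : \sum_a P a * f a ^+ 2 = \sum_a P a * score p q a ^+ 2 - mu ^+ 2.
    (* The square is split so that its last term sums to [0] by centring. *)
    transitivity (\sum_a (P a * score p q a ^+ 2 - mu * (P a * score p q a)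
                          - mu * (P a * f a))).
      by apply: eq_bigr => a _; rewrite /f; ring.
    by rewrite !sumrB -!mulr_sumr Pf mulr0 subr0 expr2.
  by rewrite gerBl sqr_ge0.
apply: (@le_trans _ _ ((\sum_a P a * f a ^+ 2) / (n%:R * (5 / 18 * h) ^+ 2))).
  apply: le_trans (chebyshev_prodDist PD Pf n0 t0).
  apply: ler_sum => x _; rewrite ler_wpM2l ?prodDist_ge0 // ler_nat.
  case: (lerP _ (\sum_i score p q (x i))) => // le_S.
  suff -> : n%:R * (5 / 18 * h) <= \sum_i f (x i) by [].
  have -> : \sum_i f (x i) = \sum_i score p q (x i) - n%:R * mu.
    by rewrite sumrB sumr_const card_ord mulr_natl.
  rewrite lerBrDr -mulrDr; apply: le_trans le_S.
  by rewrite ler_wpM2l // /mu; move: mean gap eh; lra.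
have nR0 : 0 < n%:R :> R by rewrite ltr0n.
apply: (@le_trans _ _ (11 / 9 * h / (n%:R * (5 / 18 * h) ^+ 2))).
  by rewrite ler_wpM2r // invr_ge0 mulr_ge0 ?sqr_ge0.
(* The constant equals [15.84], rounded up to [16]. *)
have -> : 11 / 9 * h / (n%:R * (5 / 18 * h) ^+ 2)
    = (11 / 9 * (324 / 25)) / (n%:R * h).
  by field; rewrite !gt_eqF.
by rewrite ler_wpM2r ?invr_ge0 ?mulr_ge0 ?ltW //; lra.
Qed.

(** Since [320 = 16 * 20], each of the two errors is at most [1/20]. *)
Lemma PTV_testable n p q eps : Delta p -> Delta q ->
  0 < dhel2 p q -> 0 <= eps -> eps <= dhel2 p q / 9 ->
  320 / dhel2 p q <= n%:R -> robustly_testable (@PTV R X) p q eps n.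
Proof.
move=> pD qD h0 e0 eh hn.
have nh : 320 <= n%:R * dhel2 p q by rewrite -ler_pdivrMr.
have n0 : (0 < n)%N by rewrite lt0n; apply: contraTneq nh => ->; rewrite mul0r; lra.
pose t := (\sum_a p a * score p q a + \sum_a q a * score p q a) / 2.
pose phi (x : {ffun 'I_n -> X}) (b : bool) : R :=
  (b == (n%:R * t <= \sum_i score p q (x i))%R)%:R.
have err : 16 / (n%:R * dhel2 p q) <= 20^-1.
  by rewrite ler_pdivrMr ?(lt_le_trans _ nh) //; lra.
exists phi; split.
  move=> x; split=> [b|]; first exact: ler0n.
  by rewrite big_bool /phi /=; case: (_ <= _); rewrite /= ?addr0 ?add0r.
have -> : 10^-1 = 20^-1 + 20^-1 :> R by lra.
apply: lerD; apply: ge_sup.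
- by exists (prTest p phi true), p => //; apply: PTV_center.
- move=> _ [P Pp <-]; apply: le_trans err.
  apply: le_trans (score_test_error pD qD h0 e0 eh Pp n0).
  by apply: ler_sum => x _; rewrite /phi eq_sym eqb_id.
- by exists (prTest q phi false), q => //; apply: PTV_center.
(* The second error reduces to the first with [p] and [q] exchanged, which negates both score and
   threshold. *)
- move=> _ [Q Qq <-]; apply: le_trans err; rewrite dhel2C in h0 eh *.
  apply: le_trans (score_test_error qD pD h0 e0 eh Qq n0).
  have [[Q0 _] _] := Qq.
  have -> : (\sum_a q a * score q p a + \sum_a p a * score q p a) / 2 = - t.
    rewrite /t -mulNr opprD addrC -!sumrN; congr ((_ + _) / _).
      by apply: eq_bigr => a _; rewrite scoreC mulrN.
    by apply: eq_bigr => a _; rewrite scoreC mulrN.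
  apply: ler_sum => x _; rewrite ler_wpM2l ?prodDist_ge0 // ler_nat.
  have -> : \sum_i score q p (x i) = - \sum_i score p q (x i).
    by rewrite -sumrN; apply: eq_bigr => i _; apply: scoreC.
  (* The answer [false] means strictly below the threshold; the exchanged event also contains the
     tie, so only an inequality holds. *)
  rewrite mulrN lerN2.
  by case: ltgtP.
Qed.

(** * Bounds on the sample complexities *)

(** Monotonicity of the real-valued [sup] asks for a nonempty smaller set and a bounded larger one;
    inclusion in [Delta] gives the bound [1]. *)
Lemma le_sup_prTest n (phi : {ffun 'I_n -> X} -> bool -> R) b
    (A B : set (X -> R)) : is_test phi -> (A !=set0)%classic ->
  (A `<=` B)%classic -> (B `<=` @Delta R X)%classic ->
  sup [set prTest P phi b | P in A]%classic
    <= sup [set prTest P phi b | P in B]%classic.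
Proof.
move=> phiP [P AP] AB BD; apply: ge_sup; first by exists (prTest P phi b), P.
move=> _ [Q AQ <-]; apply: ub_le_sup; last by exists Q => //; apply: AB.
by exists 1 => _ [S BS <-]; apply: prTest_le1 => //; apply: BD.
Qed.

Lemma nstar_mono (A B : (X -> R) -> R -> set (X -> R)) p q eps :
  A p eps p -> A q eps q ->
  (A p eps `<=` B p eps)%classic -> (A q eps `<=` B q eps)%classic ->
  (B p eps `<=` @Delta R X)%classic -> (B q eps `<=` @Delta R X)%classic ->
  (nstar A p q eps <= nstar B p q eps)%E.
Proof.
move=> Ap Aq ABp ABq BDp BDq; apply: ereal_inf_le_tmp => _ [n [phi [phiP err]] <-].
exists n => //; exists phi; split => //; apply: le_trans err.
by apply: lerD; apply: le_sup_prTest => //; [exists p|exists q].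
Qed.

Lemma nstar_ge (A : (X -> R) -> R -> set (X -> R)) p q eps :
  A p eps p -> A q eps q ->
  (A p eps `<=` @Delta R X)%classic -> (A q eps `<=` @Delta R X)%classic ->
  ((2^-1)%:E * ((dhel2 p q)%:E)^-1 <= nstar A p q eps)%E.
Proof.
move=> Ap Aq ADp ADq; apply/ereal_infP => _ [n [phi [phiP err]] <-].
have [pD qD] := (ADp _ Ap, ADq _ Aq).
have low : 2^-1 <= n%:R * dhel2 p q.
  apply: (@prTest_lower _ _ n phi) => //; apply: le_trans err.
  apply: lerD; apply: ub_le_sup.
  - by exists 1 => _ [P AP <-]; apply: prTest_le1 => //; apply: ADp.
  - by exists p.
  - by exists 1 => _ [P AP <-]; apply: prTest_le1 => //; apply: ADq.
  - by exists q.
(* If [dhel2 p q = 0] the left side is infinite, but then [low] is absurd: no [n] is testable. *)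
rewrite inver; case: eqVneq low => [->|hN0 low].
  by rewrite mulr0 => low; exfalso; lra.
by rewrite -EFinM lee_fin ler_pdivrMr // lt_neqAle eq_sym hN0 dhel2_ge0.
Qed.

(** Rounding [320 / h] up costs at most one sample, and [1 <= 2 / h] because [h = dhel2 p q] is at
    most [2]; hence [322]. *)
Lemma nstar_PTV_le p q eps : Delta p -> Delta q ->
  0 <= eps -> eps <= dhel2 p q / 9 ->
  (nstar (@PTV R X) p q eps <= 322%:E * ((dhel2 p q)%:E)^-1)%E.
Proof.
move=> pD qD e0 eh; rewrite inver; case: eqVneq => [_|hN0].
  by rewrite gt0_muley ?lte_fin // leey.
have h0 : 0 < dhel2 p q by rewrite lt_neqAle eq_sym hN0 dhel2_ge0.
pose n := (Num.trunc (320 / dhel2 p q)).+1.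
have hn : 320 / dhel2 p q < n%:R := truncnS_gt _.
apply: ge_ereal_inf; exists n%:R%:E.
  by exists n => //; apply: PTV_testable => //; apply: ltW.
rewrite -EFinM lee_fin ler_pdivlMr // /n -natr1 mulrDl mul1r.
have : (Num.trunc (320 / dhel2 p q))%:R <= 320 / dhel2 p q.
  by rewrite truncn_le divr_ge0 // ltW.
rewrite ler_pdivlMr // => H; have := dhel2_le2 pD qD; lra.
Qed.

End UncertaintySets.

(** Both quantities are compared through [z], by multiplication only, since [z] may be infinite. *)
Lemma lee_comparable (R : realType) (a b c C : R) (x y z : \bar R) :
  0 <= c -> 0 <= C -> c * b <= a -> b <= C * a -> (0 <= z)%E ->
  (a%:E * z <= x <= b%:E * z)%E -> (a%:E * z <= y <= b%:E * z)%E ->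
  (c%:E * x <= y <= C%:E * x)%E.
Proof.
move=> c0 C0 cb Ca z0 /andP[zx xz] /andP[zy yz]; apply/andP; split.
  apply: le_trans zy; apply: (@le_trans _ _ (c%:E * (b%:E * z))%E).
    by rewrite lee_wpmul2l.
  by rewrite muleA -EFinM lee_wpmul2r.
apply: (le_trans yz); apply: (@le_trans _ _ (C%:E * (a%:E * z))%E).
  by rewrite muleA -EFinM lee_wpmul2r.
by rewrite lee_wpmul2l.
Qed.

Theorem proposition4p2 (R : realType) :
  exists c C : R, [/\ 0 < c, 0 < C &
    forall (X : finType) (p q : X -> R) (eps : R),
      Delta p -> Delta q ->
      0 <= eps -> eps <= dhel2 p q / 9 ->
      [/\ (c%:E * nstar (@PHub R X) p q eps <= nstar (@PTV R X) p q eps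
             <= C%:E * nstar (@PHub R X) p q eps)%E,
          (c%:E * nstar (@PSub R X) p q eps <= nstar (@PHub R X) p q eps
             <= C%:E * nstar (@PSub R X) p q eps)%E &
          (c%:E * ((dhel2 p q)%:E)^-1 <= nstar (@PSub R X) p q eps
             <= C%:E * ((dhel2 p q)%:E)^-1)%E]].
Proof.
(* [644] is the ratio of the upper constant [322] to the lower constant [1/2]. *)
have c0 : 0 < 644^-1 :> R by rewrite invr_gt0 ltr0n.
have C0 : 0 < 644 :> R by rewrite ltr0n.
exists 644^-1, 644; split=> [||X p q eps pD qD e0 eh]; [exact: c0|exact: C0|].
have cb : 644^-1 * 322 <= 2^-1 :> R by lra.
have Ca : 322 <= 644 * 2^-1 :> R by lra.
set z := ((dhel2 p q)%:E^-1)%E.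
have z0 : (0 <= z)%E by rewrite inve_ge0 lee_fin dhel2_ge0.
have e01 : 0 <= eps <= 1.
  by rewrite e0; have := dhel2_le2 pD qD; move: eh; lra.
have TVD r : (@PTV R X r eps `<=` @Delta R X)%classic by move=> P [].
have bound (A : (X -> R) -> R -> set (X -> R)) : A p eps p -> A q eps q ->
    (A p eps `<=` PTV p eps)%classic -> (A q eps `<=` PTV q eps)%classic ->
    ((2^-1)%:E * z <= nstar A p q eps <= 322%:E * z)%E.
  move=> Ap Aq ATVp ATVq; apply/andP; split.
    by apply: nstar_ge => // P AP; [apply: TVD (ATVp _ AP)|apply: TVD (ATVq _ AP)].
  apply: le_trans (nstar_PTV_le pD qD e0 eh).
  exact: nstar_mono.
have TVb : ((2^-1)%:E * z <= nstar (@PTV R X) p q eps <= 322%:E * z)%E.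
  by apply: bound => //; apply: PTV_center.
have Hubb : ((2^-1)%:E * z <= nstar (@PHub R X) p q eps <= 322%:E * z)%E.
  by apply: bound; [apply: PHub_center..|apply: PHub_sub_PTV|apply: PHub_sub_PTV].
have Subb : ((2^-1)%:E * z <= nstar (@PSub R X) p q eps <= 322%:E * z)%E.
  by apply: bound; [apply: PSub_center..|apply: PSub_sub_PTV|apply: PSub_sub_PTV].
(* Sandwiching [z] itself lets the same comparison lemma settle the third equivalence. *)
have zb : ((2^-1)%:E * z <= z <= 322%:E * z)%E.
  rewrite -[X in (_ <= X <= _)%E]mul1e.
  by apply/andP; split; rewrite lee_wpmul2r // lee_fin; lra.
by split; apply: (lee_comparable (ltW c0) (ltW C0) cb Ca z0).
Qed.
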